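(* Let $\eta$ be the natural inclusion of $\ell^1$ complexes into $\ell^\infty$ complexes, $\eta:\overline{N}_+\Rightarrow\overline{N}_{\max}$, and let $\varphi:\mathrm{id}\Rightarrow\operatorname{Loc}_J$ be $J$-localization (the natural quotient map), where $J_r=\{s: s<r\}$. Then $\eta$ and $\varphi$ induce natural transformations of functors $\mathbb{R}\text{-}\mathbf{Gph}\to\mathbf{Ab}^{\mathbb{R}^{\mathrm{op}}}$ fitting (in each homological degree) into the commutative square $$\begin{array}{ccc}\text{Global }\ell^1\text{ homology}&\overset{\varphi}{\Longrightarrow}&\text{Magnitude homology}\\ {\scriptstyle\eta}\Downarrow&&\Downarrow{\scriptstyle\eta}\\ \text{Persistent homology}&\underset{\varphi}{\Longrightarrow}&\text{Local }\ell^\infty\text{ homology}\end{array}$$ where global $\ell^1$ homology is $H_\bullet\overline{N}_+$, persistent homology is $H_\bullet\overline{N}_{\max}$, magnitude homology is $H_\bullet\operatorname{Loc}_J\overline{N}_+$, and local $\ell^\infty$ homology is $H_\bullet\operatorname{Loc}_J\overline{N}_{\max}$.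
   Context: $\mathbb{R}$ denotes the poset of extended nonnegative reals $0\le r\le\infty$ with the reverse of the usual order, so that $\mathbb{R}^{\mathrm{op}}$ has the usual order $\le$. An $\mathbb{R}$-graph $X$ is a set of vertices (also written $X$) with $X(a,b)\in[0,\infty]$ for each ordered pair, such that $X(a,a)=0$; a morphism $f:X\to Y$ is a function with $X(a,b)\ge Y(fa,fb)$. These form $\mathbb{R}\text{-}\mathbf{Gph}$. $\mathbf{sAb}$ is the category of simplicial abelian groups and $\mathbf{Ab}$ that of abelian groups; $\mathbf{C}^{\mathbb{R}^{\mathrm{op}}}$ is the category of functors from $\mathbb{R}^{\mathrm{op}}$ to $\mathbf{C}$. For $\otimes$ equal to $+$ or $\max$, the nerve $N_\otimes(X)$ of an $\mathbb{R}$-graph $X$ is the functor from $\mathbb{R}^{\mathrm{op}}$ to simplicial sets for which $N_\otimes(X)(r)_n$ is the set of tuples $(x_0,\dots,x_n)$ of vertices for which there exist $r_1,\dots,r_n\in[0,\infty]$ with $r_1\otimes\cdots\otimes r_n\le r$ and $X(x_i,x_j)\le r_{i+1}\otimes\cdots\otimes r_j$ for all $0\le i\le j\le n$ (the empty product is $0$). Faces omit and degeneracies repeat a vertex, $r\le s$ acts by inclusion, and graph morphisms act vertexwise. One has $N_+(X)(r)_n\subseteq N_{\max}(X)(r)_n$; this natural inclusion is $\eta:N_+\Rightarrow N_{\max}$. The complex $\overline{N}_\otimes(X)\in\mathbf{sAb}^{\mathbb{R}^{\mathrm{op}}}$ is obtained by applying the free abelian group functor to $N_\otimes(X)$; $\overline{N}_+$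 is the $\ell^1$ complex and $\overline{N}_{\max}$ the $\ell^\infty$ complex, and the induced inclusion $\overline{N}_+\Rightarrow\overline{N}_{\max}$ is also written $\eta$. For $A\in\mathbf{sAb}^{\mathbb{R}^{\mathrm{op}}}$, $\operatorname{Loc}_J(A)\in\mathbf{sAb}^{\mathbb{R}^{\mathrm{op}}}$ is $\operatorname{Loc}_J(A)(r)=A(r)/A(J_r)$, where $A(J_r)\subseteq A(r)$ is the simplicial subgroup that is the union of the images of $A(s)\to A(r)$ for $s<r$ (the zero subgroup if $r=0$), with induced structure maps. $\varphi_A:A\to\operatorname{Loc}_J(A)$ is the quotient map. $H_\bullet:\mathbf{sAb}^{\mathbb{R}^{\mathrm{op}}}\to\mathbf{Ab}^{\mathbb{R}^{\mathrm{op}}}$ takes, pointwise on $\mathbb{R}^{\mathrm{op}}$, the homology of the normalized Moore complex of a simplicial abelian group (degree $n$ part: $A_n$ modulo the subgroup generated by degenerate elements; differential the alternating sum of face maps). *)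

(* Defs.v *)
Set Warnings "-notation-overridden,-ambiguous-paths,-redundant-canonical-projection,-projection-no-head-constant".
From HB Require Import structures.
From mathcomp Require Import freeg.
From mathcomp Require Import all_boot all_order all_algebra.
From mathcomp Require Import zify.
From mathcomp Require Import boolp classical_sets reals constructive_ereal.
Import Order.TTheory GRing.Theory Num.Theory.
Set Implicit Arguments.
Unset Strict Implicit.
Unset Printing Implicit Defensive.
Local Open Scope ring_scope.

Record category := Category {
  obj :> Type;
  hom : obj -> obj -> Type;
  idm : forall a, hom a a;
  cmp : forall a b c, hom b c -> hom a b -> hom a c;
  cmp1m : forall a b (f : hom a b), cmp (idm b) f = f;
  cmpm1 : forall a b (f : hom a b), cmp f (idm a) = f;
  cmpA : forall a b c d (h : hom c d) (g : hom b c) (f : hom a b),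
    cmp h (cmp g f) = cmp (cmp h g) f }.
Arguments idm {c} a : rename.
Arguments cmp {c a0 b c0} g f : rename.

Record functor (C D : category) := Functor {
  fobj :> C -> D;
  fmap : forall a b, hom a b -> hom (fobj a) (fobj b);
  fmap1 : forall a, fmap (idm a) = idm (fobj a);
  fmapM : forall a b c (g : hom b c) (f : hom a b),
    fmap (cmp g f) = cmp (fmap g) (fmap f) }.
Arguments fmap {C D} F {a b} f : rename.

Record nattrans (C D : category) (F G : functor C D) := NatTrans {
  ncomp :> forall a, hom (F a) (G a);
  ncompP : forall a b (f : hom a b),
    cmp (ncomp b) (fmap F f) = cmp (fmap G f) (ncomp a) }.

Lemma nattrans_ext C D (F G : functor C D) (s t : nattrans F G) :
  (forall a, s a = t a) -> s = t.
Proof.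
case: s t => [s sP] [t tP] /= E.
have {}E : s = t by apply: functional_extensionality_dep.
by subst t; congr NatTrans; exact: Prop_irrelevance.
Qed.

Section NatTransOps.
Variables C D : category.

Definition nid (F : functor C D) : nattrans F F.
Proof.
refine (@NatTrans C D F F (fun a => idm (F a)) _).
by move=> a b f; rewrite cmp1m cmpm1.
Defined.

Definition vcomp (F G H : functor C D) (t : nattrans G H) (s : nattrans F G) :
  nattrans F H.
Proof.
refine (@NatTrans C D F H (fun a => cmp (t a) (s a)) _) => a b f.
by rewrite -cmpA ncompP cmpA ncompP cmpA.
Defined.

Definition functor_cat : category.
Proof.
refine (@Category (functor C D) (@nattrans C D) nid vcomp _ _ _).
- by move=> F G s; apply: nattrans_ext => a; exact: cmp1m.
- by move=> F G s; apply: nattrans_ext => a; exact: cmpm1.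
- by move=> F G H K u t s; apply: nattrans_ext => a; exact: cmpA.
Defined.

End NatTransOps.

Definition op (C : category) : category.
Proof.
refine (@Category C (fun a b => hom b a) idm (fun a b c g f => cmp f g)
  _ _ _) => *.
- exact: cmpm1.
- exact: cmp1m.
- by rewrite cmpA.
Defined.

Definition fid (C : category) : functor C C.
Proof. by refine (@Functor C C (fun a => a) (fun a b f => f) _ _). Defined.

Definition fcomp (C D E : category) (G : functor D E) (F : functor C D) :
  functor C E.
Proof.
refine (@Functor C E (fun a => G (F a)) (fun a b f => fmap G (fmap F f))
  _ _) => *.
- by rewrite !fmap1.
- by rewrite !fmapM.
Defined.

Definition whiskerl (C D E : category) (G : functor D E) (F F' : functor C D)
  (s : nattrans F F') : nattrans (fcomp G F) (fcomp G F').
Proof.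
refine (@NatTrans C E (fcomp G F) (fcomp G F') (fun a => fmap G (s a)) _).
by move=> a b f /=; rewrite -!fmapM ncompP.
Defined.

(* The functor C^I -> D^I given by composition with G : C -> D. *)
Definition postcomp (I C D : category) (G : functor C D) :
  functor (functor_cat I C) (functor_cat I D).
Proof.
refine (@Functor (functor_cat I C) (functor_cat I D)
  (fun F => fcomp G F) (fun F F' s => whiskerl G s) _ _) => *.
- by apply: nattrans_ext => i /=; rewrite fmap1.
- by apply: nattrans_ext => i /=; rewrite fmapM.
Defined.

Definition set_cat : category.
Proof.
by refine (@Category Type (fun A B => A -> B) (fun A x => x)
  (fun A B C g f x => g (f x)) _ _ _).
Defined.

Lemma additive_ext (A B : zmodType) (f g : {additive A -> B}) : f =1 g -> f = g.
Proof.
case: f g => [f [[fP]]] [g [[gP]]] /= /funext E; subst g.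
by rewrite (Prop_irrelevance fP gP).
Qed.

Definition ab_cat : category.
Proof.
refine (@Category zmodType (fun A B : zmodType => {additive A -> B})
  (fun A => (idfun : {additive A -> A}))
  (fun A B C (g : {additive B -> C}) (f : {additive A -> B}) =>
     (g \o f : {additive A -> C})) _ _ _) => *; exact: additive_ext.
Defined.

(* {classic S} only endows the bare type S with the choiceType structure that
   {freeg _ / int} requires. *)
Definition free_map (S T : Type) (f : S -> T) :
    {freeg {classic S} / int} -> {freeg {classic T} / int} :=
  fglift (fun x : {classic S} =>
    << (f x : {classic T}) >> : {freeg {classic T} / int}).

Lemma free_map_additive S T (f : S -> T) : zmod_morphism (free_map f).
Proof. exact: lift_is_additive. Qed.
HB.instance Definition _ S T (f : S -> T) :=
  GRing.isZmodMorphism.Build _ _ (free_map f) (free_map_additive f).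

Lemma free_mapU S T (f : S -> T) k (x : {classic S}) :
  free_map f << k *g x >> = << k *g (f x : {classic T}) >>.
Proof.
rewrite /free_map liftU; apply/eqP/freeg_eqP => y.
by rewrite coeffZ !coeffU mul1r.
Qed.

Lemma free_ext S (V : zmodType) (f g : {additive {freeg {classic S} / int} -> V}) :
  (forall k x, f << k *g x >> = g << k *g x >>) -> f = g.
Proof.
move=> E; apply: additive_ext => a; rewrite -[a]freeg_sumE !raddf_sum.
by apply: eq_bigr => x _; exact: E.
Qed.

Definition free_ab : functor set_cat ab_cat.
Proof.
refine (@Functor set_cat ab_cat
  (fun S => ({freeg {classic S} / int} : zmodType))
  (fun S T f => (free_map f : {additive _ -> _})) _ _).
- by move=> S; apply: free_ext => k x; exact: free_mapU.
- move=> S T U g f; apply: free_ext => k x /=.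
  by rewrite !free_mapU.
Defined.

Definition quot_map (V W : zmodType) (S : zmodClosed V) (T : zmodClosed W)
    (f : {additive V -> W}) of {homo f : x / x \in S >-> x \in T} :
    Quotient.quot S -> Quotient.quot T :=
  fun q => \pi_(Quotient.quot T)%qT (f (repr q)).

Lemma quot_mapE (V W : zmodType) (S : zmodClosed V) (T : zmodClosed W) (f : {additive V -> W}) fST (x : V) :
  @quot_map V W S T f fST (\pi_(Quotient.quot S) x)%qT = (\pi_(Quotient.quot T) (f x))%qT.
Proof.
apply/eqP; rewrite /quot_map -Quotient.idealrBE -raddfB; apply: fST.
by rewrite Quotient.idealrBE reprK.
Qed.

Lemma quot_map_additive (V W : zmodType) (S : zmodClosed V) (T : zmodClosed W) (f : {additive V -> W}) fST : zmod_morphism (@quot_map V W S T f fST).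
Proof.
move=> p q; rewrite -[p]reprK -[q]reprK -raddfB !quot_mapE raddfB.
exact: raddfB.
Qed.
HB.instance Definition _ (V W : zmodType) (S : zmodClosed V) (T : zmodClosed W) (f : {additive V -> W}) fST :=
  GRing.isZmodMorphism.Build _ _ (@quot_map V W S T f fST)
    (@quot_map_additive V W S T f fST).

Lemma quot_map_id (V : zmodType) (S : zmodClosed V) (f : {additive V -> V}) fSS :
  f =1 id -> @quot_map V V S S f fSS =1 id.
Proof. by move=> f1 q; rewrite -[q]reprK quot_mapE f1. Qed.

Lemma quot_map_comp (U V W : zmodType) (S : zmodClosed U) (T : zmodClosed V)
    (X : zmodClosed W) (f : {additive U -> V}) (g : {additive V -> W})
    (h : {additive U -> W}) fST gTX hSX : h =1 g \o f ->
  @quot_map U W S X h hSX =1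
  @quot_map V W T X g gTX \o @quot_map U V S T f fST.
Proof.
by move=> hE q; rewrite -[q]reprK /= (quot_mapE hSX) (quot_mapE fST) (quot_mapE gTX) hE.
Qed.

Lemma quot_ext (V W : zmodType) (S : zmodClosed V) (f g : {additive Quotient.quot S -> W}) :
  (forall x, f (\pi_(Quotient.quot S) x)%qT = g (\pi_(Quotient.quot S) x)%qT) -> f = g.
Proof. by move=> E; apply: additive_ext => q; rewrite -[q]reprK. Qed.

Definition subgroup (V : zmodType) (S : zmodClosed V) := {x : V | x \in S}.
HB.instance Definition _ (V : zmodType) (S : zmodClosed V) := [isSub of @subgroup V S for sval].
HB.instance Definition _ (V : zmodType) (S : zmodClosed V) := [Choice of @subgroup V S by <:].
HB.instance Definition _ (V : zmodType) (S : zmodClosed V) := [SubChoice_isSubZmodule of @subgroup V S by <:].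

Record complex := Complex {
  cobj :> nat -> zmodType;
  diff : forall n, {additive cobj n.+1 -> cobj n};
  diffK : forall n x, diff n (diff n.+1 x) = 0 }.

Record cmap (C D : complex) := CMap {
  capp :> forall n, {additive C n -> D n};
  cappP : forall n x, capp n (diff C n x) = diff D n (capp n.+1 x) }.

Lemma cmap_ext (C D : complex) (f g : cmap C D) : (forall n, f n = g n) -> f = g.
Proof.
case: f g => [f fP] [g gP] /= E.
have {}E : f = g by apply: functional_extensionality_dep.
by subst g; congr CMap; exact: Prop_irrelevance.
Qed.

Definition cmap_id (C : complex) : cmap C C.
Proof.
by refine (@CMap C C (fun n => (idfun : {additive C n -> C n})) _).
Defined.

Definition cmap_comp (C D E : complex) (g : cmap D E) (f : cmap C D) : cmap C E.
Proof.
refine (@CMap C E (fun n => (g n \o f n : {additive _ -> _})) _).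
by move=> n x /=; rewrite !cappP.
Defined.

Definition complex_cat : category.
Proof.
refine (@Category complex cmap cmap_id cmap_comp _ _ _) => *;
  by apply: cmap_ext => n; apply: additive_ext.
Defined.

(* The complex is extended by 0 in degree -1. *)
Definition cycles (C : complex) (n : nat) : {pred C n} :=
  match n return {pred C n} with
  | 0 => predT
  | m.+1 => [pred x | diff C m x == 0]
  end.

Lemma cycles_closed (C : complex) n : zmod_closed (@cycles C n).
Proof.
case: n => [|n]; split=> // [|x y]; rewrite !inE ?raddf0 //.
by move=> /eqP dx /eqP dy; rewrite raddfB dx dy subr0.
Qed.
HB.instance Definition _ (C : complex) n :=
  GRing.isZmodClosed.Build (C n) (@cycles C n) (@cycles_closed C n).

Definition boundaries (C : complex) (n : nat) : {pred subgroup (@cycles C n)} :=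
  [pred z | `[< exists y, \val z = diff C n y >]].

Lemma boundaries_closed (C : complex) n : zmod_closed (@boundaries C n).
Proof.
split=> [|x y]; rewrite !inE.
  by exists 0; rewrite !raddf0.
move=> [a xa] [b yb]; exists (a - b).
by rewrite !raddfB /= xa yb.
Qed.
HB.instance Definition _ (C : complex) n :=
  GRing.isZmodClosed.Build _ (@boundaries C n) (@boundaries_closed C n).

Lemma cycles_cmap (C D : complex) (f : cmap C D) n x : x \in @cycles C n -> f n x \in @cycles D n.
Proof.
case: n x => [//|n] x; rewrite !inE => /eqP dx.
by rewrite -cappP dx raddf0.
Qed.

Definition sub_map (V W : zmodType) (S : zmodClosed V) (T : zmodClosed W)
    (f : {additive V -> W}) (fST : forall x, x \in S -> f x \in T) :
    subgroup S -> subgroup T :=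
  fun z => exist _ (f (\val z)) (fST _ (valP z)).
Lemma sub_map_additive (V W : zmodType) (S : zmodClosed V) (T : zmodClosed W) (f : {additive V -> W}) fST : zmod_morphism (@sub_map V W S T f fST).
Proof. by move=> x y; apply: val_inj; rewrite /= !raddfB. Qed.
HB.instance Definition _ (V W : zmodType) (S : zmodClosed V) (T : zmodClosed W) (f : {additive V -> W}) fST :=
  GRing.isZmodMorphism.Build _ _ (@sub_map V W S T f fST)
    (@sub_map_additive V W S T f fST).

Lemma boundaries_cmap (C D : complex) (f : cmap C D) n :
  {homo sub_map (@cycles_cmap C D f n) : z / z \in @boundaries C n >-> z \in @boundaries D n}.
Proof.
move=> z; rewrite !inE => -[y zy]; exists (f n.+1 y).
by rewrite /= zy cappP.
Qed.

Definition complex_homology (n : nat) : functor complex_cat ab_cat.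
Proof.
refine (@Functor complex_cat ab_cat
  (fun C => Quotient.quot (@boundaries C n) : zmodType)
  (fun C D f => quot_map (@boundaries_cmap C D f n) : {additive _ -> _}) _ _).
- by move=> C; apply: additive_ext; apply: quot_map_id => z; exact: val_inj.
- move=> C D E g f; apply: additive_ext; apply: quot_map_comp => z.
  exact: val_inj.
Defined.

Record mono (m n : nat) := Mono {
  mapp :> 'I_m.+1 -> 'I_n.+1;
  mappP : forall i j : 'I_m.+1, (i <= j)%N -> (mapp i <= mapp j)%N }.

Lemma mono_ext m n (f g : mono m n) : f =1 g -> f = g.
Proof.
case: f g => [f fP] [g gP] /= /funext E; subst g.
by congr Mono; exact: Prop_irrelevance.
Qed.

(* The object n stands for the ordinal [n] = {0 < ... < n}. *)
Definition simplex_cat : category.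
Proof.
refine (@Category nat mono (fun n => @Mono n n id (fun _ _ => id))
  (fun k m n g f => @Mono k n (g \o f) (fun i j ij => mappP g (mappP f ij)))
  _ _ _) => *; exact: mono_ext.
Defined.

Lemma face_mono n (i : 'I_n.+2) (j k : 'I_n.+1) :
  (j <= k)%N -> (lift i j <= lift i k)%N.
Proof. by rewrite /= leq_bump2. Qed.

Definition face n (i : 'I_n.+2) : mono n n.+1 := Mono (@face_mono n i).

Lemma degen_lt n (i : 'I_n.+1) (j : 'I_n.+2) : (unbump i j < n.+1)%N.
Proof.
rewrite /unbump; have := ltn_ord i; have := ltn_ord j.
by case: ltnP => /=; rewrite ?subn0 ?subn1 => *; lia.
Qed.

Lemma degen_mono n (i : 'I_n.+1) (j k : 'I_n.+2) :
  (j <= k)%N -> (unbump i j <= unbump i k)%N.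
Proof. by rewrite /unbump; lia. Qed.

(* unbump i j is j if j <= i and j - 1 otherwise: degen i hits i twice. *)
Definition degen n (i : 'I_n.+1) : mono n.+1 n :=
  @Mono n.+1 n (fun j => Ordinal (degen_lt i j)) (@degen_mono n i).

Definition sSet := functor_cat (op simplex_cat) set_cat.
Definition sAb := functor_cat (op simplex_cat) ab_cat.

Lemma face_face n (i : 'I_n.+2) (j : 'I_n.+3) (i' : 'I_n.+2) (j' : 'I_n.+3) :
  (i < j)%N -> i' = j.-1 :> nat -> j' = i :> nat ->
  cmp (face j : @hom simplex_cat _ _) (face i) =
  cmp (face j' : @hom simplex_cat _ _) (face i').
Proof.
move=> ij ei ej; apply: mono_ext => k; apply: val_inj => /=.
by rewrite ei ej /bump; lia.
Qed.

Lemma degen_face_id n (i : 'I_n.+1) (j : 'I_n.+2) :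
  (j == i :> nat) || (j == i.+1 :> nat) ->
  cmp (degen i : @hom simplex_cat _ _) (face j) = idm (n : simplex_cat).
Proof.
move=> ij; apply: mono_ext => k; apply: val_inj => /=.
by rewrite /bump /unbump; lia.
Qed.

Lemma degen_face n (i : 'I_n.+2) (j : 'I_n.+3) :
  j != i :> nat -> j != i.+1 :> nat ->
  exists (i' : 'I_n.+1) (j' : 'I_n.+2),
  cmp (degen i : @hom simplex_cat _ _) (face j) =
  cmp (face j' : @hom simplex_cat _ _) (degen i').
Proof.
move=> ji ji1; have := ltn_ord i; have := ltn_ord j => jn i_n.
case: (ltnP j i) => ij.
  have lt1 : (i.-1 < n.+1)%N by lia.
  have lt2 : (j < n.+2)%N by lia.
  exists (Ordinal lt1), (Ordinal lt2).
  apply: mono_ext => k; apply: val_inj => /=; have := ltn_ord k.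
  by rewrite /bump /unbump; lia.
have lt1 : (i < n.+1)%N by lia.
have lt2 : (j.-1 < n.+2)%N by lia.
exists (Ordinal lt1), (Ordinal lt2).
apply: mono_ext => k; apply: val_inj => /=; have := ltn_ord k.
by rewrite /bump /unbump; lia.
Qed.

(* The subgroup generated by G, as the intersection of the subgroups
   containing G. *)
Definition generated (V : zmodType) (G : set V) : {pred V} :=
  [pred x | `[< forall S : {pred V}, zmod_closed S ->
                  (forall y, G y -> y \in S) -> x \in S >]].

Lemma generated_closed (V : zmodType) (G : set V) : zmod_closed (generated G).
Proof.
split=> [|x y]; rewrite !inE; first by move=> S [].
by move=> xG yG S Scl GS; apply: (Scl.2); [exact: xG|exact: yG].
Qed.
HB.instance Definition _ (V : zmodType) (G : set V) :=
  GRing.isZmodClosed.Build V (generated G) (generated_closed G).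

Lemma generated_map (V W : zmodType) (G : set V) (T : zmodClosed W)
    (f : {additive V -> W}) :
  (forall y, G y -> f y \in T) -> {homo f : x / x \in generated G >-> x \in T}.
Proof.
move=> GT x; rewrite inE => /(_ [pred x | f x \in T]); apply => //.
by split=> [|y z]; rewrite !inE ?raddf0 ?rpred0 // raddfB => *; rewrite rpredB.
Qed.

Section Moore.
Variable A : sAb.

Definition face_map n (i : 'I_n.+2) : {additive A n.+1 -> A n} :=
  fmap A (face i : @hom (op simplex_cat) n.+1 n).
Definition degen_map n (i : 'I_n.+1) : {additive A n -> A n.+1} :=
  fmap A (degen i : @hom (op simplex_cat) n n.+1).

Definition alt n (x : A n.+1) : A n := \sum_(i < n.+2) face_map i x *~ (-1) ^+ i.

Lemma alt_additive n : zmod_morphism (@alt n).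
Proof.
by move=> x y; rewrite /alt -sumrB; apply: eq_bigr => i _; rewrite raddfB mulrzBl.
Qed.
HB.instance Definition _ n :=
  GRing.isZmodMorphism.Build _ _ (@alt n) (@alt_additive n).

Definition degenerate n : set (A n) :=
  match n return set (A n) with
  | 0 => set0
  | m.+1 => [set x | exists i y, x = @degen_map m i y]
  end.

Lemma alt_degenerate n (x : A n.+1) :
  degenerate x -> alt x \in generated (@degenerate n).
Proof.
case=> i [y ->].
have dsE j : face_map j (degen_map i y) =
    fmap A (cmp (degen i : @hom simplex_cat _ _) (face j) : @hom (op simplex_cat) n n) y.
  by rewrite (@fmapM _ _ A _ _ _ (face j : @hom (op simplex_cat) n.+1 n) (degen i : @hom (op simplex_cat) n n.+1)).
have dsid (j : 'I_n.+2) : (j == i :> nat) || (j == i.+1 :> nat) ->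
    face_map j (degen_map i y) = y.
  by move=> ij; rewrite dsE degen_face_id // (@fmap1 _ _ A).
have lt0 : (i < n.+2)%N by have := ltn_ord i; lia.
have lt1 : (i.+1 < n.+2)%N by have := ltn_ord i; lia.
rewrite /alt (bigD1 (Ordinal lt0)) //= (bigD1 (Ordinal lt1)) /=; last first.
  by rewrite -val_eqE /=; lia.
rewrite !dsid ?eqxx ?orbT // addrA -mulrzDr exprS mulN1r subrr mulr0z add0r.
apply: rpred_sum => j /andP[]; rewrite -!val_eqE /= => ji ji1.
apply: rpredMz; rewrite dsE.
case: n i y {x} dsE dsid lt0 lt1 j ji ji1 => [|n] i y dsE dsid lt0 lt1 j ji ji1.
  by have := ltn_ord j; have := ltn_ord i; lia.
have [i' [j' E]] := degen_face ji ji1.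
rewrite inE => S Scl GS; apply: GS; exists i', (face_map j' y).
rewrite E.
by rewrite (@fmapM _ _ A _ _ _ (degen i' : @hom (op simplex_cat) n n.+1) (face j' : @hom (op simplex_cat) n.+1 n)).
Qed.

Lemma alt_alt n (x : A n.+2) : alt (alt x) = 0.
Proof.
pose c (i : 'I_n.+2) (j : 'I_n.+3) := face_map i (face_map j x).
have cE i j : c i j = fmap A (cmp (face j : @hom simplex_cat _ _) (face i) : @hom (op simplex_cat) n.+2 n) x.
  by rewrite (@fmapM _ _ A _ _ _ (face i : @hom (op simplex_cat) n.+1 n) (face j : @hom (op simplex_cat) n.+2 n.+1)).
have -> : alt (alt x) = \sum_(p : 'I_n.+2 * 'I_n.+3) c p.1 p.2 *~ (-1) ^+ (p.1 + p.2).
  rewrite -(pair_bigA _ (fun i j => c i j *~ (-1) ^+ (i + j))) /=.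
  apply: eq_bigr => i _.
  rewrite /alt raddf_sum mulrz_suml; apply: eq_bigr => j _.
  by rewrite raddfMz -mulrzA mulrC -exprD.
rewrite (bigID (fun p : 'I_n.+2 * 'I_n.+3 => (p.1 < p.2)%N)) /=.
pose h (p : 'I_n.+2 * 'I_n.+3) : 'I_n.+2 * 'I_n.+3 := (inord p.2, inord p.1.+1).
pose k (p : 'I_n.+2 * 'I_n.+3) : 'I_n.+2 * 'I_n.+3 := (inord p.2.-1, inord p.1).
rewrite (reindex_onto h k) /=; last first.
  case=> i j /= ij; have := ltn_ord i; have := ltn_ord j => jn i_n.
  congr pair; apply: val_inj; rewrite /= !inordK ?ltnS //; lia.
rewrite -[X in _ + X]opprK -sumrN; apply/eqP; rewrite subr_eq0; apply/eqP.
have hk p : ((h p).1 < (h p).2)%N && (k (h p) == p) = ~~ (p.1 < p.2)%N.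
  case: p => i j; have := ltn_ord i; have := ltn_ord j => jn i_n.
  rewrite xpair_eqE -!val_eqE /= /inord !val_insubd /=.
  by repeat (case: ifP => ?; rewrite ?ltn0Sn ?if_same /=); lia.
apply: eq_big => [p|[i j]]; rewrite hk // -leqNgt /= => ji.
have jn : (j < n.+2)%N by have := ltn_ord i; lia.
have ej : (inord j : 'I_n.+2) = j :> nat by rewrite inordK.
have ei : (inord i.+1 : 'I_n.+3) = i.+1 :> nat by rewrite inordK // ltnS ltn_ord.
rewrite -mulrNz ei ej addnS [(j + i)%N]addnC exprS mulN1r; congr (_ *~ _).
by rewrite !cE (@face_face _ _ _ i j) ?ei ?ej.
Qed.

(* The normalized complex in its quotient form: A_n modulo degeneracies. *)
Definition moore_obj n : zmodType := Quotient.quot (generated (@degenerate n)).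

Definition moore_diff n : {additive moore_obj n.+1 -> moore_obj n} :=
  quot_map (generated_map (@alt_degenerate n)).

Lemma moore_diffK n (q : moore_obj n.+2) : moore_diff n (moore_diff n.+1 q) = 0.
Proof.
rewrite -[q]reprK /moore_diff /= (quot_mapE (generated_map (@alt_degenerate n.+1))).
by rewrite (quot_mapE (generated_map (@alt_degenerate n))) /= alt_alt raddf0.
Qed.

Definition moore_complex := Complex moore_diffK.
End Moore.

Lemma degenerate_nat (A B : sAb) (f : hom A B) n (x : A n) :
  degenerate x -> f n x \in generated (@degenerate B n).
Proof.
case: n x => [//|n] x [i [y ->]]; rewrite inE => S _ GS; apply: GS; exists i, (f n y).
have := ncompP f (degen i : @hom (op simplex_cat) n n.+1).
by move/(congr1 (fun h : {additive A n -> B n.+1} => h y)).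
Qed.

Lemma alt_nat (A B : sAb) (f : hom A B) n (x : A n.+1) :
  f n (alt x) = alt (f n.+1 x).
Proof.
rewrite /alt raddf_sum; apply: eq_bigr => i _; rewrite raddfMz; congr (_ *~ _).
have := ncompP f (face i : @hom (op simplex_cat) n.+1 n).
by move/(congr1 (fun h : {additive A n.+1 -> B n} => h x)).
Qed.

Definition moore_map (A B : sAb) (f : hom A B) :
  cmap (moore_complex A) (moore_complex B).
Proof.
refine (@CMap (moore_complex A) (moore_complex B)
  (fun n => quot_map (generated_map (@degenerate_nat A B f n)) : {additive _ -> _}) _).
move=> n q /=; rewrite -[q]reprK.
rewrite (quot_mapE (generated_map (@alt_degenerate A n))).
rewrite (quot_mapE (generated_map (@degenerate_nat A B f n))).
rewrite (quot_mapE (generated_map (@degenerate_nat A B f n.+1))).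
rewrite (quot_mapE (generated_map (@alt_degenerate B n))).
by congr (\pi%qT); exact: alt_nat.
Defined.

Definition moore : functor sAb complex_cat.
Proof.
refine (@Functor sAb complex_cat moore_complex moore_map _ _).
- by move=> A; apply: cmap_ext => n; apply: additive_ext; rewrite /moore_map; apply: quot_map_id.
- by move=> A B C g f; apply: cmap_ext => n; apply: additive_ext; rewrite /moore_map; apply: quot_map_comp.
Defined.

Section Reals.
Variable R : realType.

Definition ennreal := {x : \bar R | (0 <= x)%E}.
HB.instance Definition _ := [isSub of ennreal for sval].
HB.instance Definition _ := [Order of ennreal by <:].

Definition ennreal0 : ennreal := exist _ 0%E (lexx _).
Definition ennreal_add (r s : ennreal) : ennreal :=
  exist _ (val r + val s)%E (adde_ge0 (valP r) (valP s)).
Definition ennreal_max (r s : ennreal) : ennreal := Order.max r s.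

Lemma ennreal_gt0 (r s : ennreal) : (s < r)%O -> r <> ennreal0.
Proof.
move=> sr r0; move: sr; rewrite r0 => /lt_geF.
by have : (ennreal0 <= s)%O := valP s; move=> ->.
Qed.

(* The category of the poset [0, +oo] with its usual order, i.e., the opposite
   of the poset of extended nonnegative reals under the reverse order. *)
Definition Rop : category.
Proof.
by refine (@Category ennreal (fun r s => (r <= s)%O) (fun r => lexx r)
  (fun r s t st rs => le_trans rs st) _ _ _) => *; exact: Prop_irrelevance.
Defined.

Lemma Rop_irr (r s : Rop) (f g : hom r s) : f = g.
Proof. exact: (@Prop_irrelevance (r <= s)%O f g). Qed.

Section LocJ.
Variable A : functor_cat Rop sAb.

(* A(J_r) in simplicial degree n: the union of the images of A(s) -> A(r) for
   s < r. The first disjunct only matters for r = 0, where this union is empty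
   and A(J_0) is the zero subgroup. *)
Definition J_sub (r : Rop) (n : nat) : {pred A r n} :=
  [pred a | `[< (r = ennreal0 /\ a = 0) \/
     exists (s : ennreal) (sr : (s < r)%O) (b : A s n),
       a = fmap A (ltW sr : @hom Rop s r) n b >]].

Lemma fmap_trans (r s t : ennreal) (rs : (r <= s)%O) (st : (s <= t)%O) (rt : (r <= t)%O) n (b : A r n) :
  fmap A (st : @hom Rop s t) n (fmap A (rs : @hom Rop r s) n b) = fmap A (rt : @hom Rop r t) n b.
Proof.
have -> : rt = @cmp Rop r s t st rs by exact: Rop_irr.
by rewrite fmapM.
Qed.

Lemma J_sub_closed r n : zmod_closed (@J_sub r n).
Proof.
split=> [|x y]; rewrite !inE.
  have [->|r0] := eqVneq r ennreal0; first by left.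
  have lt0 : (ennreal0 < r)%O.
    by rewrite lt_neqAle eq_sym r0 /=; exact: (valP r).
  by right; exists ennreal0, lt0, 0; rewrite raddf0.
case=> [[r0 ->] [[_ ->]|]|].
- by left; rewrite subr0.
- by case=> s [sr]; case: (ennreal_gt0 sr).
move=> [s [sr [b ->]]] [[r0]|[s' [sr' [b' ->]]]].
  by case: (ennreal_gt0 sr).
have mr : (Order.max s s' < r)%O by rewrite gt_max sr.
have sm : (s <= Order.max s s')%O by rewrite le_max lexx.
have sm' : (s' <= Order.max s s')%O by rewrite le_max lexx orbT.
right; exists (Order.max s s'), mr.
exists (fmap A (sm : @hom Rop _ _) n b - fmap A (sm' : @hom Rop _ _) n b').
by rewrite raddfB (fmap_trans _ _ (ltW sr)) (fmap_trans _ _ (ltW sr')).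
Qed.
HB.instance Definition _ r n :=
  GRing.isZmodClosed.Build (A r n) (@J_sub r n) (@J_sub_closed r n).

Lemma J_sub_simp r m n (t : @hom (op simplex_cat) m n) :
  {homo (fmap (A r) t : {additive _ -> _}) : x / x \in @J_sub r m >-> x \in @J_sub r n}.
Proof.
move=> x; rewrite !inE => -[[r0 ->]|[s [sr [b ->]]]]; first by left; rewrite raddf0.
right; exists s, sr, (fmap (A s) t b).
have := ncompP (fmap A (ltW sr : @hom Rop s r)) t.
by move/(congr1 (fun h : {additive A s m -> A r n} => h b)).
Qed.

Lemma J_sub_shift (r s : Rop) (rs : hom r s) n :
  {homo (fmap A rs n : {additive _ -> _}) : x / x \in @J_sub r n >-> x \in @J_sub s n}.
Proof.
move=> x; rewrite !inE.
have [es|r'] := eqVneq r s.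
  subst s. have -> : rs = idm r by exact: Rop_irr.
  by rewrite fmap1.
have ltrs : (r < s)%O by rewrite lt_neqAle r'.
move=> _. right. exists r, ltrs, x; congr (fmap A _ n x). exact: Rop_irr.
Qed.

Definition loc_simp (r : Rop) : sAb.
Proof.
refine (@Functor (op simplex_cat) ab_cat
  (fun n => Quotient.quot (@J_sub r n) : zmodType)
  (fun m n t => quot_map (@J_sub_simp r m n t) : {additive _ -> _}) _ _).
- by move=> n; apply: additive_ext; apply: quot_map_id => x; rewrite fmap1.
- by move=> k m n g f; apply: additive_ext; apply: quot_map_comp => x; rewrite fmapM.
Defined.

Definition loc_shift (r s : Rop) (rs : hom r s) : hom (loc_simp r) (loc_simp s).
Proof.
refine (@NatTrans _ _ (loc_simp r) (loc_simp s)
  (fun n => quot_map (@J_sub_shift r s rs n) : {additive _ -> _}) _).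
move=> m n t; apply: quot_ext => x /=.
rewrite (quot_mapE (J_sub_simp t)) (quot_mapE (J_sub_shift rs (n:=m))).
rewrite (quot_mapE (J_sub_simp t)) (quot_mapE (J_sub_shift rs (n:=n))).
congr (\pi%qT).
have := ncompP (fmap A rs) t.
by move/(congr1 (fun h : {additive A r m -> A s n} => h x)).
Defined.

Definition loc_obj : functor_cat Rop sAb.
Proof.
refine (@Functor Rop sAb loc_simp loc_shift _ _).
- by move=> r; apply: nattrans_ext => n; apply: additive_ext; apply: quot_map_id => x; rewrite fmap1.
- by move=> r s t g f; apply: nattrans_ext => n; apply: additive_ext; apply: quot_map_comp => x; rewrite fmapM.
Defined.

Definition loc_proj_simp (r : Rop) : hom (A r) (loc_simp r).
Proof.
refine (@NatTrans _ _ (A r) (loc_simp r)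
  (fun n => (\pi_(Quotient.quot (@J_sub r n)))%qT : {additive _ -> _}) _).
move=> m n t; apply: additive_ext => x.
by rewrite /= (quot_mapE (J_sub_simp t)).
Defined.

Definition loc_proj : hom A loc_obj.
Proof.
refine (@NatTrans _ _ A loc_obj loc_proj_simp _).
move=> r s rs; apply: nattrans_ext => n; apply: additive_ext => x.
by rewrite /= (quot_mapE (J_sub_shift rs (n:=n))).
Defined.

End LocJ.

Lemma J_sub_nat (A B : functor_cat Rop sAb) (f : hom A B) (r : Rop) n :
  {homo (f r n : {additive _ -> _}) : x / x \in @J_sub A r n >-> x \in @J_sub B r n}.
Proof.
move=> x; rewrite !inE => -[[r0 ->]|[s [sr [b ->]]]]; first by left; rewrite raddf0.
right; exists s, sr, (f s n b).
have := ncompP f (ltW sr : @hom Rop s r).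
by move/(congr1 (fun h : @nattrans _ _ (A s : functor _ _) (B r) => (h n : {additive A s n -> B r n}) b)).
Qed.

Definition loc_map_simp (A B : functor_cat Rop sAb) (f : hom A B) (r : Rop) :
  hom (loc_simp A r) (loc_simp B r).
Proof.
refine (@NatTrans _ _ (loc_simp A r) (loc_simp B r)
  (fun n => quot_map (@J_sub_nat A B f r n) : {additive _ -> _}) _).
move=> m n t; apply: quot_ext => x /=.
rewrite (quot_mapE (J_sub_simp t)) (quot_mapE (J_sub_nat f (r := r) (n:=m))).
rewrite (quot_mapE (J_sub_nat f (r := r) (n:=n))) (quot_mapE (J_sub_simp t)).
congr (\pi%qT).
have := ncompP (f r) t.
by move/(congr1 (fun h : {additive A r m -> B r n} => h x)).
Defined.

Definition loc_map (A B : functor_cat Rop sAb) (f : hom A B) :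
  hom (loc_obj A) (loc_obj B).
Proof.
refine (@NatTrans _ _ (loc_obj A) (loc_obj B) (loc_map_simp f) _).
move=> r s rs; apply: nattrans_ext => n; apply: quot_ext => x /=.
rewrite (quot_mapE (J_sub_shift rs (n:=n))).
rewrite (quot_mapE (J_sub_nat f (r := r) (n:=n))).
rewrite (quot_mapE (J_sub_nat f (r := s) (n:=n))).
rewrite (quot_mapE (J_sub_shift rs (n:=n))).
congr (\pi%qT).
have := ncompP f rs.
by move/(congr1 (fun h : @nattrans _ _ (A r : functor _ _) (B s) =>
  (h n : {additive A r n -> B s n}) x)).
Defined.

Definition Loc : functor (functor_cat Rop sAb) (functor_cat Rop sAb).
Proof.
refine (@Functor (functor_cat Rop sAb) (functor_cat Rop sAb) loc_obj loc_map _ _).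
- move=> A; apply: nattrans_ext => r; apply: nattrans_ext => n; apply: additive_ext.
  exact: quot_map_id.
- move=> A B C g f; apply: nattrans_ext => r; apply: nattrans_ext => n; apply: additive_ext.
  exact: quot_map_comp.
Defined.

Definition phi : nattrans (fid (functor_cat Rop sAb)) Loc.
Proof.
refine (@NatTrans _ _ (fid (functor_cat Rop sAb)) Loc loc_proj _).
move=> A B f; apply: nattrans_ext => r; apply: nattrans_ext => n; apply: additive_ext => x /=.
by rewrite (quot_mapE (J_sub_nat f (r := r) (n:=n))).
Defined.

Variant tensor := Plus | Max.
Definition tens (o : tensor) : ennreal -> ennreal -> ennreal :=
  match o with Plus => ennreal_add | Max => ennreal_max end.

Record rgraph := RGraph {
  vertex :> Type;
  gdist : vertex -> vertex -> ennreal;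
  gdistxx : forall a, gdist a a = ennreal0 }.

Record rgraph_map (X Y : rgraph) := RGraphMap {
  gapp :> X -> Y;
  gappP : forall a b, (gdist (gapp a) (gapp b) <= gdist a b)%O }.

Lemma rgraph_map_ext (X Y : rgraph) (f g : rgraph_map X Y) : f =1 g -> f = g.
Proof.
case: f g => [f fP] [g gP] /= /funext E; subst g.
by congr RGraphMap; exact: Prop_irrelevance.
Qed.

Definition rgph : category.
Proof.
by refine (@Category rgraph rgraph_map
  (fun X => @RGraphMap X X id (fun _ _ => lexx _))
  (fun X Y Z g f => @RGraphMap X Z (g \o f) (fun a b => le_trans (gappP g _ _) (gappP f a b)))
  _ _ _) => *; apply: rgraph_map_ext.
Defined.

Section Nerve.
Variable o : tensor.

(* With indices from 0, rr k is r_{k+1}: the range i <= k < j gives the product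
   r_{i+1} (x) ... (x) r_j, and the empty product is 0 for both tensors. *)
Definition nerve_simplex (X : rgraph) (r : ennreal) (n : nat) (x : 'I_n.+1 -> X) : Prop :=
  exists2 rr : 'I_n -> ennreal,
    (\big[tens o/ennreal0]_(k < n) rr k <= r)%O &
    forall i j : 'I_n.+1, (i <= j)%N ->
      (gdist (x i) (x j) <= \big[tens o/ennreal0]_(k < n | (i <= k < j)%N) rr k)%O.

Lemma tensA : associative (tens o).
Proof.
case: o => x y z; first by apply: val_inj; rewrite /= addeA.
exact: maxA.
Qed.

Lemma tensC : commutative (tens o).
Proof.
case: o => x y; first by apply: val_inj; rewrite /= addeC.
exact: maxC.
Qed.

Lemma tens0 : left_id ennreal0 (tens o).
Proof.
case: o => x; first by apply: val_inj; rewrite /= add0e.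
by apply/max_idPr; exact: (valP x).
Qed.
HB.instance Definition _ := Monoid.isComLaw.Build ennreal ennreal0 (tens o) tensA tensC tens0.

Lemma tens_ler a b : (a <= tens o a b)%O.
Proof.
case: o; last by rewrite /= /ennreal_max le_max lexx.
by change (val a <= val a + val b)%E; rewrite leeDl // (valP b).
Qed.

Lemma tens_interval n (rr : 'I_n -> ennreal) (a b c : nat) : (a <= b)%N -> (b <= c)%N ->
  \big[tens o/ennreal0]_(k < n | (a <= k < c)%N) rr k =
  tens o (\big[tens o/ennreal0]_(k < n | (a <= k < b)%N) rr k)
         (\big[tens o/ennreal0]_(k < n | (b <= k < c)%N) rr k).
Proof.
move=> ab bc; rewrite (bigID (fun k : 'I_n => (k < b)%N)) /=.
by congr (tens o); apply: eq_bigl => k; lia.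
Qed.

Lemma tens_reindex m n (rr : 'I_n -> ennreal) (t : mono m n) (i j : 'I_m.+1) : (i <= j)%N ->
  \big[tens o/ennreal0]_(k < m | (i <= k < j)%N)
     \big[tens o/ennreal0]_(l < n | (t (inord k) <= l < t (inord k.+1))%N) rr l =
  \big[tens o/ennreal0]_(l < n | (t i <= l < t j)%N) rr l.
Proof.
case: j => j jm /=; elim: j jm => [|j IH] jm.
  rewrite leqn0 => /eqP i0; have -> : i = Ordinal jm by apply: val_inj.
  by rewrite !big_pred0 => // l; rewrite ?[in LHS]/=; lia.
rewrite leq_eqVlt => /orP[/eqP ij|].
  have -> : i = Ordinal jm by apply: val_inj.
  by rewrite !big_pred0 => // l; rewrite ?[in LHS]/=; lia.
rewrite ltnS => ij; have jm' : (j < m.+1)%N by lia.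
have jm'' : (j < m)%N by lia.
rewrite (bigD1 (Ordinal jm'')) /=; last by lia.
rewrite tensC (eq_bigl (fun k : 'I_m => (i <= k < j)%N)); last first.
  by move=> k; rewrite -val_eqE /=; lia.
rewrite (IH jm' ij) (@tens_interval _ _ (t i) (t (Ordinal jm')) (t (Ordinal jm))).
- congr (tens o _ _); apply: eq_bigl => l.
  congr (_ <= _ < _)%N; congr (nat_of_ord (t _)); apply: val_inj => /=; exact: inordK.
- exact: mappP.
- by apply: mappP => /=.
Qed.

Lemma nerve_mono (X : rgraph) r m n (t : mono m n) (x : 'I_n.+1 -> X) :
  nerve_simplex r x -> nerve_simplex r (x \o t).
Proof.
move=> [rr rrr xrr].
exists (fun k : 'I_m => \big[tens o/ennreal0]_(l < n | (t (inord k) <= l < t (inord k.+1))%N) rr l).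
  apply: le_trans rrr.
  rewrite (eq_bigl (fun k : 'I_m => ((ord0 : 'I_m.+1) <= k < (ord_max : 'I_m.+1))%N)) => [|k]; last by rewrite ltn_ord.
  by rewrite tens_reindex //= [leRHS](bigID (fun l : 'I_n => (t ord0 <= l < t ord_max)%N)) tens_ler.
by move=> i j ij; rewrite tens_reindex // xrr // mappP.
Qed.

Lemma nerve_le (X : rgraph) (r s : ennreal) n (x : 'I_n.+1 -> X) : (r <= s)%O ->
  nerve_simplex r x -> nerve_simplex s x.
Proof. by move=> rs [rr h1 h2]; exists rr => //; exact: le_trans rs. Qed.

Lemma nerve_map (X Y : rgraph) (f : rgraph_map X Y) r n (x : 'I_n.+1 -> X) :
  nerve_simplex r x -> nerve_simplex r (f \o x).
Proof.
move=> [rr h1 h2]; exists rr => // i j ij.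
by apply: le_trans (h2 i j ij); exact: gappP.
Qed.

Definition nerve_set (X : rgraph) (r : Rop) (n : nat) : Type :=
  {x : 'I_n.+1 -> X | nerve_simplex r x}.

Lemma nerve_set_ext (X : rgraph) (r : Rop) n (x y : nerve_set X r n) :
  sval x =1 sval y -> x = y.
Proof.
case: x y => [x xP] [y yP] /= /funext E; subst y.
by congr exist; exact: Prop_irrelevance.
Qed.

Definition nerve_simp (X : rgraph) (r : Rop) : sSet.
Proof.
refine (@Functor (op simplex_cat) set_cat (nerve_set X r)
  (fun m n t (x : nerve_set X r m) =>
     exist _ (sval x \o t) (nerve_mono t (svalP x))) _ _).
- by move=> n; apply: funext => x; exact: nerve_set_ext.
- by move=> k m n g f; apply: funext => x; exact: nerve_set_ext.
Defined.

Definition nerve_shift (X : rgraph) (r s : Rop) (rs : hom r s) :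
  hom (nerve_simp X r) (nerve_simp X s).
Proof.
refine (@NatTrans _ _ (nerve_simp X r) (nerve_simp X s)
  (fun n (x : nerve_set X r n) => exist _ (sval x) (nerve_le rs (svalP x))) _).
by move=> m n t; apply: funext => x; exact: nerve_set_ext.
Defined.

Definition nerve_obj (X : rgraph) : functor_cat Rop sSet.
Proof.
refine (@Functor Rop sSet (nerve_simp X) (@nerve_shift X) _ _).
- by move=> r; apply: nattrans_ext => n; apply: funext => x; exact: nerve_set_ext.
- by move=> r s t g f; apply: nattrans_ext => n; apply: funext => x; exact: nerve_set_ext.
Defined.

Definition nerve_hom_simp (X Y : rgraph) (f : rgraph_map X Y) (r : Rop) :
  hom (nerve_simp X r) (nerve_simp Y r).
Proof.
refine (@NatTrans _ _ (nerve_simp X r) (nerve_simp Y r)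
  (fun n (x : nerve_set X r n) =>
     exist _ (f \o sval x) (nerve_map f (svalP x))) _).
by move=> m n t; apply: funext => x; exact: nerve_set_ext.
Defined.

Definition nerve_hom (X Y : rgraph) (f : rgraph_map X Y) :
  hom (nerve_obj X) (nerve_obj Y).
Proof.
refine (@NatTrans _ _ (nerve_obj X) (nerve_obj Y) (nerve_hom_simp f) _).
move=> r s rs; apply: nattrans_ext => n; apply: funext => x.
exact: nerve_set_ext.
Defined.

Definition nerve : functor rgph (functor_cat Rop sSet).
Proof.
refine (@Functor rgph (functor_cat Rop sSet) nerve_obj nerve_hom _ _).
- by move=> X; apply: nattrans_ext => r; apply: nattrans_ext => n; apply: funext => x; exact: nerve_set_ext.
- by move=> X Y Z g f; apply: nattrans_ext => r; apply: nattrans_ext => n; apply: funext => x; exact: nerve_set_ext.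
Defined.

Definition nerve_ab : functor rgph (functor_cat Rop sAb) :=
  fcomp (postcomp Rop (postcomp (op simplex_cat) free_ab)) nerve.

End Nerve.

Lemma nerve_plus_max (X : rgraph) (r : ennreal) n (x : 'I_n.+1 -> X) :
  nerve_simplex Plus r x -> nerve_simplex Max r x.
Proof.
move=> [rr rrr xrr].
have maxr (P : pred 'I_n) : (\big[tens Max/ennreal0]_(k < n | P k) r <= r)%O.
  by elim/big_ind: _ => // [|a b ar br]; [exact: (valP r)|rewrite ge_max ar].
exists (fun _ => r); first exact: maxr.
move=> i j; rewrite leq_eqVlt => /orP[/eqP/val_inj ->|ij].
  by rewrite gdistxx; exact: (valP (\big[tens Max/ennreal0]_(k < n | _) _)).
have jn : (i < n)%N by have := ltn_ord j; lia.
rewrite (bigD1 (Ordinal jn)) /= ?leqnn ?ij // le_max; apply/orP; left.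
apply: le_trans rrr; apply: le_trans (xrr i j (ltnW ij)) _.
rewrite [leRHS](bigID (fun k : 'I_n => (i <= k < j)%N)); exact: tens_ler.
Qed.

Definition eta_simp (X : rgraph) (r : Rop) :
  hom (nerve_simp Plus X r) (nerve_simp Max X r).
Proof.
refine (@NatTrans _ _ (nerve_simp Plus X r) (nerve_simp Max X r)
  (fun n (x : nerve_set Plus X r n) =>
     exist _ (sval x) (nerve_plus_max (svalP x))) _).
by move=> m n t; apply: funext => x; exact: nerve_set_ext.
Defined.

Definition eta_obj (X : rgraph) : hom (nerve_obj Plus X) (nerve_obj Max X).
Proof.
refine (@NatTrans _ _ (nerve_obj Plus X) (nerve_obj Max X) (eta_simp X) _).
move=> r s rs; apply: nattrans_ext => n; apply: funext => x.
exact: nerve_set_ext.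
Defined.

Definition eta_set : nattrans (nerve Plus) (nerve Max).
Proof.
refine (@NatTrans _ _ (nerve Plus) (nerve Max) eta_obj _).
move=> X Y f; apply: nattrans_ext => r; apply: nattrans_ext => n.
by apply: funext => x; exact: nerve_set_ext.
Defined.

Definition l1_complex := nerve_ab Plus.
Definition linf_complex := nerve_ab Max.

Definition eta : nattrans l1_complex linf_complex :=
  whiskerl (postcomp Rop (postcomp (op simplex_cat) free_ab)) eta_set.

Definition homology (n : nat) :
    functor (functor_cat Rop sAb) (functor_cat Rop ab_cat) :=
  postcomp Rop (fcomp (complex_homology n) moore).

Definition global_l1_homology n : functor rgph (functor_cat Rop ab_cat) :=
  fcomp (homology n) l1_complex.
Definition persistent_homology n : functor rgph (functor_cat Rop ab_cat) :=
  fcomp (homology n) linf_complex.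
Definition magnitude_homology n : functor rgph (functor_cat Rop ab_cat) :=
  fcomp (homology n) (fcomp Loc l1_complex).
Definition local_linf_homology n : functor rgph (functor_cat Rop ab_cat) :=
  fcomp (homology n) (fcomp Loc linf_complex).

End Reals.

(* Main.v *)
(* The square over X is the image under homology of the naturality square of
   phi at eta_X, so only the functoriality of homology is used. *)
Require Import Defs.
From mathcomp Require Import ssreflect ssrbool reals.

(** All four edges are whiskerings of [phi] and [eta], so nothing about nerves or quotients enters:
    [fid_whisker_square] gives the square for any natural [p] from the identity. *)

(* Whiskering with F on the right, with source F itself: fcomp (fid D) F is not
   convertible to F, because their functor laws have different proofs. *)
Lemma fid_whisker_natural (C D : category) (L : functor D D)
    (p : nattrans (fid D) L) (F : functor C D) (a b : C) (f : hom a b) :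
  cmp (p (F b)) (fmap F f) = cmp (fmap (fcomp L F) f) (p (F a)).
Proof. exact: (ncompP p (fmap F f)). Qed.

Definition fid_whisker (C D : category) (L : functor D D)
    (p : nattrans (fid D) L) (F : functor C D) : nattrans F (fcomp L F) :=
  @NatTrans _ _ F (fcomp L F) (fun a => p (F a))
    (fid_whisker_natural _ _ L p F).

(** At each object [a], [H] is applied to the naturality square of [p] at the morphism [e a]. *)
Lemma fid_whisker_square (C D E : category) (H : functor D E) (L : functor D D)
    (p : nattrans (fid D) L) (F G : functor C D) (e : nattrans F G) :
  vcomp (whiskerl H (whiskerl L e)) (whiskerl H (fid_whisker _ _ L p F)) =
  vcomp (whiskerl H (fid_whisker _ _ L p G)) (whiskerl H e).
Proof.
apply: nattrans_ext => a /=; rewrite -!fmapM.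
by congr (fmap H _); rewrite -(ncompP p (e a)).
Qed.

Theorem theorem25 (R : realType) (n : nat) :
  exists (phi_plus : nattrans (global_l1_homology R n) (magnitude_homology R n))
         (phi_max : nattrans (persistent_homology R n) (local_linf_homology R n))
         (eta_glob : nattrans (global_l1_homology R n) (persistent_homology R n))
         (eta_loc : nattrans (magnitude_homology R n) (local_linf_homology R n)),
  [/\ forall X : rgph R,
        phi_plus X = fmap (homology R n) (phi R (l1_complex R X)),
      forall X : rgph R,
        phi_max X = fmap (homology R n) (phi R (linf_complex R X)),
      forall X : rgph R,
        eta_glob X = fmap (homology R n) (eta R X),
      forall X : rgph R,
        eta_loc X = fmap (homology R n) (fmap (Loc R) (eta R X)) &
      vcomp eta_loc phi_plus = vcomp phi_max eta_glob].
Proof.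
exists (whiskerl (homology R n) (fid_whisker _ _ (Loc R) (phi R) (l1_complex R))).
exists (whiskerl (homology R n) (fid_whisker _ _ (Loc R) (phi R) (linf_complex R))).
exists (whiskerl (homology R n) (eta R)).
exists (whiskerl (homology R n) (whiskerl (Loc R) (eta R))).
(* Components of whiskerings compute to the prescribed morphisms, so the four formulas hold by
   conversion. *)
split; [by [] | by [] | by [] | by [] |].
exact: fid_whisker_square.
Qed.
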